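(* Let $\eta>0$, $\lambda>0$, $\varepsilon\ge0$, let $\ell:\mathbb{R}\to\mathbb{R}$ be a differentiable $1$-Lipschitz loss function, and consider linear predictors $f_\theta(x)=\langle\theta,x\rangle$, $x,\theta\in\mathbb{R}^d$. Let $\theta_t$ be the $t$-th gradient descent iterate on the training set $(x_i,y_i)_{i=1}^n$ started at $\theta_0$, where $x_i\in\mathbb{R}^d$, $\|x_i\|\le1$, $y_i\in\{-1,1\}$. If $x'\in\mathbb{R}^d$ satisfies $\max_i|\langle x_i,x'\rangle|\le\varepsilon$, then for every $t$ $$|\langle\theta_t,x'\rangle|\le|\langle\theta_0,x'\rangle|(1-\eta\lambda)^t+\varepsilon\,\frac{1-(1-\eta\lambda)^t}{\lambda}.$$ In particular, if $\theta_t'$ is the $t$-th gradient descent iterate (same $\eta,\lambda,\ell$) on a second training set $(x_i',y_i')_{i=1}^n$ with $\|x_i'\|\le1$, $y_i'\in\{-1,1\}$, started at $\theta_0'$, and $x\in\mathbb{R}^d$ satisfies $\max_i|\langle x_i',x\rangle|\le\varepsilon$, then $$|f_{\theta_t+\theta_t'}(x)-f_{\theta_t}(x)|\le|\langle\theta_0',x\rangle|(1-\eta\lambda)^t+\varepsilon\,\frac{1-(1-\eta\lambda)^t}{\lambda}.$$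
   Context: Gradient descent on $\frac1n\sum_i\ell(y_i\langle\theta,x_i\rangle)+\frac\lambda2\|\theta\|_2^2$ is the iteration $\theta_{s+1}=(1-\lambda\eta)\theta_s-\frac\eta n\sum_{i=1}^n\ell'(y_i\langle\theta_s,x_i\rangle)\,x_iy_i$ for $s=0,1,2,\dots$.
   Formalization: The formal theorem adds the assumption ηλ ≤ 1; without it the bound fails (e.g. d = n = 1, x_1 = 0, θ_0 = x' = 1, ε = 0, η = 2, λ = 1, t = 1 gives 1 ≤ −1), and likewise for every ηλ > 1. *)

(* Defs.v *)
From HB Require Import structures.
From mathcomp Require Import all_boot all_order all_algebra.
From mathcomp Require Import all_classical all_reals all_analysis.

Set Implicit Arguments.
Unset Strict Implicit.
Unset Printing Implicit Defensive.

Import Order.TTheory GRing.Theory Num.Theory.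
Import numFieldNormedType.Exports.

Local Open Scope ring_scope.

Definition inner (R : realType) (d : nat) (u v : 'rV[R]_d) : R :=
  \sum_(k < d) u 0 k * v 0 k.

(* The canonical norm `|u| of a row vector is the sup norm, hence this
   separate Euclidean norm. *)
Definition norm2 (R : realType) (d : nat) (u : 'rV[R]_d) : R :=
  Num.sqrt (inner u u).

Definition predictor (R : realType) (d : nat) (theta x : 'rV[R]_d) : R :=
  inner theta x.

Definition gd_step (R : realType) (d n : nat) (eta lambda : R) (l : R -> R)
    (x : 'I_n -> 'rV[R]_d) (y : 'I_n -> R) (theta : 'rV[R]_d) : 'rV[R]_d :=
  (1 - lambda * eta) *: theta
  - (eta / n%:R) *:
      \sum_(i < n) (derive1 l (y i * predictor theta (x i)) * y i) *: x i.

Definition gd (R : realType) (d n : nat) (eta lambda : R) (l : R -> R)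
    (x : 'I_n -> 'rV[R]_d) (y : 'I_n -> R) (theta0 : 'rV[R]_d) (t : nat)
    : 'rV[R]_d :=
  iter t (gd_step eta lambda l x y) theta0.

(* Points of the closed Euclidean unit ball, with labels -1 or 1. *)
Definition training_set (R : realType) (d n : nat)
    (x : 'I_n -> 'rV[R]_d) (y : 'I_n -> R) : Prop :=
  forall i, norm2 (x i) <= 1 /\ (y i = -1 \/ y i = 1).

(* max_i |<x_i, v>|; the default value 0 of the iterated maximum is harmless
   as the terms are nonnegative. *)
Definition max_corr (R : realType) (d n : nat)
    (x : 'I_n -> 'rV[R]_d) (v : 'rV[R]_d) : R :=
  \big[Num.max/0]_(i < n) `|inner (x i) v|.

(* Main.v *)
(** One gradient step multiplies <theta, v> by 1 - eta * lambda and adds at most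
    eta * eps in absolute value, because |l'| <= 1 and every training point is
    eps-almost orthogonal to v. Iterating this affine recurrence sums a geometric
    series. The second bound is the first one applied to the second training
    run, as the predictor is linear in its parameter. *)

Require Import Defs.
From HB Require Import structures.
From mathcomp Require Import all_boot all_order all_algebra.
From mathcomp Require Import all_classical all_reals all_analysis.
From mathcomp Require Import ring.

Import Order.TTheory GRing.Theory Num.Theory.
Import numFieldNormedType.Exports.

Local Open Scope ring_scope.

(** Every difference quotient at [a] lies in the closed set [|z| <= k], which therefore contains
    their limit. *)
Lemma lipschitz_derive1_le (R : realType) (k : R) (f : R -> R) (a : R) :
  derivable f a 1 -> k.-lipschitz f -> `|derive1 f a| <= k.
Proof.
move=> df lipf; rewrite derive1E.
apply: (closed_cvg (fun z : R => `|z| <= k)) df.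
  apply: (preimage_closed (f := fun z : R => `|z|) (D := [set z | z <= k]%classic)).
    by move=> z _; exact: norm_continuous.
  exact: closed_le.
near=> h.
have h0 : h != 0 by near: h; exact: nbhs_dnbhs_neq.
have /= := lipf (h + a, a) (conj I I).
rewrite addrK /shift /= normrZ normfV [_%:A]mulr1.
by rewrite ler_pdivrMl ?normr_gt0// mulrC.
Unshelve. all: by end_near. Qed.

Section InnerLinear.
Context {R : realType} {d : nat}.
Implicit Types (a : R) (u v w : 'rV[R]_d).

Lemma innerDl u v w : inner (u + v) w = inner u w + inner v w.
Proof. by rewrite -big_split; apply: eq_bigr => k _; rewrite !mxE mulrDl. Qed.

Lemma innerZl a u w : inner (a *: u) w = a * inner u w.
Proof. by rewrite mulr_sumr; apply: eq_bigr => k _; rewrite !mxE mulrA. Qed.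

Lemma innerBl u v w : inner (u - v) w = inner u w - inner v w.
Proof. by rewrite innerDl -scaleN1r innerZl mulN1r. Qed.

Lemma inner_suml (I : finType) (F : I -> 'rV[R]_d) w :
  inner (\sum_i F i) w = \sum_i inner (F i) w.
Proof.
elim/big_ind2: _ => [|? u ? v <- <-|//]; last exact: innerDl.
(* Empty sum: writing the zero vector as [0 *: 0] lets homogeneity give [inner 0 w = 0]. *)
by rewrite -(scale0r 0) innerZl mul0r.
Qed.

End InnerLinear.

Section GradientDescent.
Context {R : realType} {d n : nat} (eta lambda eps : R) (l : R -> R).
Context (x : 'I_n -> 'rV[R]_d) (y : 'I_n -> R) (v : 'rV[R]_d).
Hypotheses (n_gt0 : (0 < n)%N) (eta_ge0 : 0 <= eta) (lambda_gt0 : 0 < lambda).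
Hypothesis eta_lambda_le1 : eta * lambda <= 1.
Hypothesis l_diff : forall u : R, derivable l u 1.
Hypothesis l_lip : 1.-lipschitz l.
Hypotheses (xy : training_set x y) (corr_le : max_corr x v <= eps).

Lemma gd_step_inner_le theta :
  `|inner (gd_step eta lambda l x y theta) v|
  <= (1 - eta * lambda) * `|inner theta v| + eta * eps.
Proof.
rewrite innerBl !innerZl inner_suml (le_trans (ler_normB _ _))// lerD//.
  (* Here [eta * lambda <= 1] makes the factor its own absolute value; past 1, the bound fails for
     [eps = 0] whenever [inner theta v] is nonzero. *)
  by rewrite normrM (mulrC lambda) ger0_norm// subr_ge0.
rewrite !normrM normfV normr_nat (ger0_norm eta_ge0) -mulrA ler_wpM2l//.
rewrite ler_pdivrMl ?ltr0n// (le_trans (ler_norm_sum _ _ _))//.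
(* Spread [n * eps] as a sum of [n] copies of [eps], to compare term by term. *)
rewrite -[n in leRHS]card_ord mulr_natl -sumr_const ler_sum// => i _.
have y1 : `|y i| = 1 by case: (xy i) => _ [] ->; rewrite ?normrN normr1.
rewrite innerZl !normrM y1 mulr1 -[leRHS]mul1r ler_pM//.
  exact: lipschitz_derive1_le.
by apply: le_trans corr_le; exact: (le_bigmax _ (fun i => `|inner (x i) v|)).
Qed.

(** With [c = 1 - eta * lambda], the quotient [(1 - c ^+ t) / lambda] is [eta] times the sum of
    [c ^+ s] over [s < t]. *)
Lemma gd_inner_le theta0 t :
  `|inner (gd eta lambda l x y theta0 t) v|
  <= `|inner theta0 v| * (1 - eta * lambda) ^+ t
     + eps * ((1 - (1 - eta * lambda) ^+ t) / lambda).
Proof.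
elim: t => [|t IHt]; first by rewrite !expr0 subrr mul0r mulr0 addr0 mulr1.
apply: (le_trans (gd_step_inner_le _)).
have c_ge0 : 0 <= 1 - eta * lambda by rewrite subr_ge0.
apply: (le_trans (lerD (ler_wpM2l c_ge0 IHt) (lexx (eta * eps)))).
(* The two sides now agree exactly: [c * (1 - c ^+ t) / lambda + eta = (1 - c ^+ t.+1) / lambda],
   since [1 - c = eta * lambda]. *)
rewrite le_eqVlt; apply/orP; left; apply/eqP.
by rewrite exprS; field; rewrite gt_eqF.
Qed.

End GradientDescent.

Theorem mainTheorem8 (R : realType) (d n : nat) (n_gt0 : (0 < n)%N)
    (eta lambda eps : R) (eta_gt0 : 0 < eta) (lambda_gt0 : 0 < lambda)
    (eps_ge0 : 0 <= eps) (eta_lambda_le1 : eta * lambda <= 1)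
    (l : R -> R) (l_diff : forall u : R, derivable l u 1)
    (l_lip : 1.-lipschitz l)
    (x : 'I_n -> 'rV[R]_d) (y : 'I_n -> R) (xy : training_set x y)
    (theta0 : 'rV[R]_d) :
  (forall x' : 'rV[R]_d, max_corr x x' <= eps ->
   forall t : nat,
     `|inner (gd eta lambda l x y theta0 t) x'|
     <= `|inner theta0 x'| * (1 - eta * lambda) ^+ t
        + eps * ((1 - (1 - eta * lambda) ^+ t) / lambda))
  /\
  (forall (x2 : 'I_n -> 'rV[R]_d) (y2 : 'I_n -> R) (theta0' : 'rV[R]_d)
          (v : 'rV[R]_d),
   training_set x2 y2 -> max_corr x2 v <= eps ->
   forall t : nat,
     `|predictor (gd eta lambda l x y theta0 t
                  + gd eta lambda l x2 y2 theta0' t) v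
       - predictor (gd eta lambda l x y theta0 t) v|
     <= `|inner theta0' v| * (1 - eta * lambda) ^+ t
        + eps * ((1 - (1 - eta * lambda) ^+ t) / lambda)).
Proof.
split=> [x' corr_le t|x2 y2 theta0' v xy2 corr_le t].
  by apply: gd_inner_le => //; exact: ltW.
(* The first run cancels, leaving only the second iterate paired with [v]. *)
rewrite /predictor innerDl addrC addKr.
by apply: gd_inner_le => //; exact: ltW.
Qed.
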